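(* Let $p$ be an odd prime. Up to isomorphism, there is a unique left brace with additive group isomorphic to $\mathbb{Z}_p^2\times\mathbb{Z}_2$ and with $|\ker\lambda|=p$. It is $(B,+,\circ)$ with $B=\mathbb{Z}_p\times\mathbb{Z}_p\times\mathbb{Z}_2$ and $$\begin{pmatrix} x_1\\ x_2\\ x_3\end{pmatrix}+\begin{pmatrix} y_1\\ y_2\\ y_3\end{pmatrix}=\begin{pmatrix} x_1+y_1\\ x_2+y_2\\ x_3+y_3\end{pmatrix},\qquad \begin{pmatrix} x_1\\ x_2\\ x_3\end{pmatrix}\circ\begin{pmatrix} y_1\\ y_2\\ y_3\end{pmatrix}=\begin{pmatrix} x_1+y_1+(-1)^{x_3}x_2y_2\\ x_2+(-1)^{x_3}y_2\\ x_3+y_3\end{pmatrix}$$ for all $x_1,x_2,y_1,y_2\in\mathbb{Z}_p$ and $x_3,y_3\in\mathbb{Z}_2$. In particular, $(B,\circ)\cong\mathcal{G}_0$.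
   Context: A skew (left) brace is a triple $(B,+,\circ)$ where $(B,+)$ and $(B,\circ)$ are groups such that $a\circ(b+c)=a\circ b-a+a\circ c$ for all $a,b,c\in B$; it is a left brace if $(B,+)$ is abelian. The map $\lambda:(B,\circ)\to\mathrm{Aut}(B,+)$, $\lambda_a(b)=-a+a\circ b$, is a group homomorphism, with kernel $\ker\lambda$. Isomorphisms are bijections preserving both operations. $\mathcal{G}_0=\langle\sigma,\tau,\epsilon\mid\sigma^p=\tau^p=\epsilon^2=1,\ [\sigma,\tau]=1,\ \epsilon\sigma\epsilon^{-1}=\sigma^{-1},\ \epsilon\tau\epsilon^{-1}=\tau\rangle$. *)

(* Defs.v *)
From HB Require Import structures.
From mathcomp Require Import all_boot all_order all_algebra all_fingroup.

Set Implicit Arguments.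
Unset Strict Implicit.
Unset Printing Implicit Defensive.

Import GRing.Theory.
Local Open Scope ring_scope.

(* Registers the product of two finZmodTypes as a finZmodType; the library
   only provides its finType and zmodType structures separately. *)
HB.instance Definition _ (A B : finZmodType) := GRing.Zmodule.on (A * B)%type.

(* The structure of a left brace with additive group A: as A is a zmodType,
   the additive group is abelian. The group axioms for the second operation
   are given in their one-sided form. *)
Record left_brace (A : finZmodType) := LeftBrace {
  circ : A -> A -> A;
  circ_one : A;
  circ_inv : A -> A;
  circA : associative circ;
  circ1x : left_id circ_one circ;
  circVx : left_inverse circ_one circ_inv circ;
  circD : forall a b c : A, circ a (b + c) = circ a b - a + circ a c
}.

(* The carrier, seen as the finite group (B, circ). *)
Definition circ_group (A : finZmodType) (S : left_brace A) : Type := A.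

HB.instance Definition _ (A : finZmodType) (S : left_brace A) :=
  Finite.on (circ_group S).
HB.instance Definition _ (A : finZmodType) (S : left_brace A) :=
  Finite_isGroup.Build (circ_group S) (circA S) (circ1x S) (circVx S).

Section LeftBrace.
Variables (A : finZmodType) (S : left_brace A).

Definition lambda (a b : A) : A := - a + circ S a b.

Definition ker_lambda : {set A} := [set a | [forall b, lambda a b == b]].

End LeftBrace.

Definition brace_isomorphic (A A' : finZmodType)
    (S : left_brace A) (S' : left_brace A') : Prop :=
  exists f : A -> A',
    [/\ bijective f,
        {morph f : x y / x + y} &
        {morph f : x y / circ S x y >-> circ S' x y}].

(* Main.v *)
(* Put P = {x | p x = 0}, K = ker lambda, which is a subgroup of order p of both
   groups, and let t be the involution of (A, +), which every lambda_a fixes.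
   P is a p-group for both operations, so lambda_x, for x in P, acts trivially
   on K and on P / K, whence lambda is additive on P.  For e0 in P \ K,
   c = lambda_{e0} e0 - e0 spans K; comparing lambda_t lambda_{e0} with
   lambda_{lambda_t e0} lambda_t gives lambda_t c = d^2 c, where d is the
   eigenvalue of lambda_t on P / K, and d^2 = 1.  As lambda_t is an involution
   other than the identity, it has an eigenvector e2 in P \ K for -1, and the
   basis e1 = lambda_{e2} e2 - e2, e2, t brings the brace to the stated form.

   For (B, o), the generators are s = (1/2, 1, 0), for which
   s^n = (n^2/2, n, 0), t = (1, 0, 0) and e = (0, 0, 1). *)
Require Import Defs.
From HB Require Import structures.
From mathcomp Require Import all_boot all_order all_algebra all_fingroup all_solvable ring.
Set Implicit Arguments.
Unset Strict Implicit.
Unset Printing Implicit Defensive.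
Import GRing.Theory.
Local Open Scope ring_scope.

(** * The map [lambda] and its kernel in an arbitrary left brace *)

Section LambdaTheory.
Variables (A : finZmodType) (S : left_brace A).
Local Notation "a 'o' b" := (circ S a b) (at level 40, left associativity).
Local Notation lam := (lambda S).
Local Notation K := (ker_lambda S).

Lemma circE a b : a o b = a + lam a b.
Proof. by rewrite /lambda addNKr. Qed.

Lemma circx0 a : a o 0 = a.
Proof.
have := circD S a 0 0; rewrite addr0 -addrA -[LHS]addr0 => /addrI/esym.
by rewrite addrC => /subr0_eq.
Qed.

Lemma circ_one_eq0 : circ_one S = 0.
Proof. by rewrite -[LHS]circx0 circ1x. Qed.

Lemma lambda_is_zmod_morphism a : zmod_morphism (lam a).
Proof.
have lamD b c : lam a (b + c) = lam a b + lam a c.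
  by rewrite /lambda circD !addrA.
by move=> b c; apply: (addIr (lam a c)); rewrite -lamD !subrK.
Qed.

HB.instance Definition _ a :=
  GRing.isZmodMorphism.Build A A (lam a) (lambda_is_zmod_morphism a).

Lemma lambdaD a b c : lam a (b + c) = lam a b + lam a c.
Proof. exact: raddfD. Qed.

Lemma lambdax0 a : lam a 0 = 0.
Proof. exact: raddf0. Qed.

Lemma lambdaB a b c : lam a (b - c) = lam a b - lam a c.
Proof. exact: raddfB. Qed.

Lemma lambdaMn a b n : lam a (b *+ n) = lam a b *+ n.
Proof. exact: raddfMn. Qed.

Lemma lambda_circ a b c : lam (a o b) c = lam a (lam b c).
Proof.
rewrite {3}/lambda raddfD raddfN /= /lambda -(circA S).
by rewrite opprD opprK addrACA subrr add0r.
Qed.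

Lemma lambda0 b : lam 0 b = b.
Proof. by rewrite -circ_one_eq0 /lambda circ1x circ_one_eq0 oppr0 add0r. Qed.

Lemma lambdaK a : cancel (lam a) (lam (circ_inv S a)).
Proof. by move=> b; rewrite -lambda_circ circVx circ_one_eq0 lambda0. Qed.

Lemma circxV a : a o circ_inv S a = 0.
Proof. by rewrite -circ_one_eq0; exact: (@mulgV (circ_group S) a). Qed.

Lemma lambdaVK a : cancel (lam (circ_inv S a)) (lam a).
Proof. by move=> b; rewrite -lambda_circ circxV lambda0. Qed.

Lemma ker_lambdaP a : reflect (forall b, lam a b = b) (a \in K).
Proof. by rewrite inE; apply: (iffP forallP) => Ka b; apply/eqP/Ka. Qed.

Lemma ker_circ k a : k \in K -> k o a = k + a.
Proof. by move/ker_lambdaP=> Kk; rewrite circE Kk. Qed.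

Lemma lambda_kerD k a b : k \in K -> lam (k + a) b = lam a b.
Proof. by move=> Kk; rewrite -ker_circ // lambda_circ; apply/ker_lambdaP. Qed.

(** On the kernel [circ] agrees with addition, so closure under [circ] is closure under addition. *)
Lemma ker_lambda_group_set : group_set K.
Proof.
apply/group_setP; split=> [|k l Kk Kl]; apply/ker_lambdaP => b.
  exact: lambda0.
by rewrite [(_ * _)%g]/(k + l) lambda_kerD //; apply/ker_lambdaP.
Qed.
Canonical ker_lambda_group := Group ker_lambda_group_set.

(** The kernel is normal for [circ], and the [circ]-conjugate of [k] by [x] is exactly [lam x k]. *)
Lemma lambda_ker x k : k \in K -> lam x k \in K.
Proof.
move=> Kk; pose c := x o k o circ_inv S x.
have Kc : c \in K.
  apply/ker_lambdaP => b; rewrite !lambda_circ (ker_lambdaP _ Kk).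
  exact: lambdaVK.
suff <- : c = lam x k by [].
apply: (addIr x); rewrite -ker_circ // [RHS]addrC -circE /c -(circA S).
by rewrite circVx circ_one_eq0 circx0.
Qed.

(* The case [N = 1] concerns eigenvectors of [lam x], the case [N = K] the
   eigenvectors of the map it induces on the quotient by [K]. *)
Lemma lambda_circ_exp (x : circ_group S) (N : {group A}) y m n :
    (forall z, z \in N -> lam x z \in N) -> lam x y - y *+ m \in N ->
  lam (x ^+ n)%g y - y *+ (m ^ n) \in N.
Proof.
move=> lamN Ny; elim: n => [|n IHn].
  have -> : (x ^+ 0)%g = 0 :> A by exact: circ_one_eq0.
  by rewrite lambda0 subrr group1.
rewrite expgS [lam _ y]lambda_circ.
have -> : lam x (lam (x ^+ n)%g y) - y *+ m ^ n.+1 =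
   lam x (lam (x ^+ n)%g y - y *+ m ^ n) + (lam x y - y *+ m) *+ m ^ n.
  by rewrite lambdaB lambdaMn mulrnBl -mulrnA -expnS addrA subrK.
by apply: groupM; [apply: lamN | apply: groupX].
Qed.

End LambdaTheory.

(** * The p-torsion subgroup and the unipotent action of [lambda] on it *)

Section GroupFacts.
Variable (A : finZmodType) (p : nat) (p_prime : prime p).
Implicit Types (N : {group A}) (y : A).

(** If p did not divide a - b, a Bezout multiple of a - b would be 1 modulo p and would put [y]
    itself in [N]. *)
Lemma mulrn_group_mod N y a b : y *+ p = 0 -> y \notin N ->
  y *+ a - y *+ b \in N -> a = b %[mod p].
Proof.
move=> yp N'y; wlog leab: a b / (b <= a)%N => [IH | yab].
  case/orP: (leq_total b a) => [|le_ab]; first exact: IH.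
  by move=> yab; apply/esym/IH => //; rewrite -opprB groupV.
move: yab; rewrite -mulrnBr // => yab; apply/eqP; rewrite eqn_mod_dvd //.
apply: contraR N'y => p'ab; have cop: coprime p (a - b)%N by rewrite prime_coprime.
have a_b_gt0: (0 < a - b)%N by rewrite lt0n; apply: contraNneq p'ab => ->.
case: (egcdnP p a_b_gt0) => u v def_u _.
have -> : y = y *+ (a - b)%N *+ u.
  rewrite -mulrnA mulnC def_u gcdnC (eqP cop) mulrnDr mulr1n mulnC mulrnA yp.
  by rewrite mul0rn add0r.
exact: groupX.
Qed.

Lemma mulrn_modp y a b : y *+ p = 0 -> a = b %[mod p] -> y *+ a = y *+ b.
Proof. by move=> yp eq_ab; have := expg_mod a yp; rewrite eq_ab expg_mod. Qed.

Lemma pexp_modp_eq1 m k : (m ^ (p ^ k))%N = 1 %[mod p] -> m = 1 %[mod p].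
Proof.
suff -> : (m ^ (p ^ k))%N = m %[mod p] by [].
elim: k => [|k IHk]; first by rewrite expn1.
by rewrite expnS expnM -modnXm fermat_little // modnXm IHk.
Qed.

Definition torsion : {set A} := [set x | x *+ p == 0].

Lemma torsionP x : reflect (x *+ p = 0) (x \in torsion).
Proof. by rewrite inE; apply: eqP. Qed.

Lemma torsion_group_set : group_set torsion.
Proof.
apply/group_setP; split=> [|x y /torsionP xp /torsionP yp]; apply/torsionP.
  exact: mul0rn.
by rewrite [(_ * _)%g]/(x + y) mulrnDl xp yp addr0.
Qed.
Canonical torsion_group := Group torsion_group_set.

Lemma torsion_pgroup : (p.-group torsion)%g.
Proof.
apply/pgroupP => q q_pr /(Cauchy q_pr)[x /torsionP xp oxq].
by rewrite inE /= -dvdn_prime2 // -oxq order_dvdn; apply/eqP.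
Qed.

Variable S : left_brace A.

(** Since each [lambda] is additive, the p-torsion is also a subgroup for [circ]. Its order, a power
    of p, is the same for both operations, so Lagrange applies in the [circ] group. *)
Lemma torsion_circ_exp x : x *+ p = 0 ->
  exists k, ((x : circ_group S) ^+ (p ^ k)%N)%g = 0.
Proof.
have gP : group_set (torsion : {set circ_group S}).
  apply/group_setP; split=> [|y z /torsionP yp /torsionP zp]; apply/torsionP.
    by rewrite [1%g]circ_one_eq0 mul0rn.
  by rewrite [(_ * _)%g]circE mulrnDl yp add0r -lambdaMn zp lambdax0.
move=> /torsionP xP; have [k oP] := p_natP torsion_pgroup; exists k.
rewrite -oP; have := @expg_cardG _ (Group gP) x xP.
by move=> ->; exact: circ_one_eq0.
Qed.

(** The eigenvalue [m] on the class of [y] satisfies m^(p^k) = 1 modulo p, as [x] has p-power [circ]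
    order; by Fermat this forces m = 1. *)
Lemma lambda_unipotent (x : A) (N : {group A}) y m : x *+ p = 0 -> y *+ p = 0 ->
    (forall z, z \in N -> lambda S x z \in N) -> lambda S x y - y *+ m \in N ->
  lambda S x y - y \in N.
Proof.
move=> xp yp lamN Ny; have [Ny0 | N'y] := boolP (y \in N).
  by apply: groupM; [apply: lamN | rewrite groupV].
have [k xk] := torsion_circ_exp xp.
have := lambda_circ_exp (p ^ k)%N lamN Ny.
rewrite xk lambda0 -{1}[y]mulr1n => /(mulrn_group_mod yp N'y)/esym.
by move=> /pexp_modp_eq1 /(mulrn_modp yp) ym; rewrite ym mulr1n in Ny.
Qed.

End GroupFacts.

(** * Additive coordinates with respect to two elements of order p and an involution *)

Section Coordinates.
Variables (p : nat) (p_prime : prime p) (p_odd : odd p).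
Local Notation V := ('Z_p * 'Z_p * 'Z_2)%type.
Variable A : finZmodType.
Implicit Types e t : A.

Lemma expg_ZpD (gT : finGroupType) m (g : gT) (i j : 'Z_m) : (1 < m)%N ->
  (g ^+ m = 1 -> g ^+ (i + j)%R = g ^+ i * g ^+ j)%g.
Proof.
move=> m_gt1 gm; rewrite -expgD -[LHS](expg_mod _ gm) -[RHS](expg_mod _ gm) /=.
by rewrite {3}Zp_cast // modn_mod.
Qed.

Lemma expg_ZpN (gT : finGroupType) m (g : gT) (i : 'Z_m) : (1 < m)%N ->
  (g ^+ m = 1 -> g ^+ (- i)%R = g ^- i)%g.
Proof.
move=> m_gt1 gm; apply: (mulIg (g ^+ i)%g).
by rewrite -expg_ZpD // addNr mulVg expg0.
Qed.

Lemma mulrn_ZpD m e (i j : 'Z_m) : (1 < m)%N -> e *+ m = 0 ->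
  e *+ (i + j)%R = e *+ i + e *+ j.
Proof. exact: expg_ZpD. Qed.

Lemma mulrn_ZpN m e (i : 'Z_m) : (1 < m)%N -> e *+ m = 0 ->
  e *+ (- i)%R = - (e *+ i).
Proof. exact: expg_ZpN. Qed.

Lemma mulrn_ZpM m e (i j : 'Z_m) : (1 < m)%N -> e *+ m = 0 ->
  e *+ (i * j)%R = e *+ i *+ j.
Proof.
move=> m_gt1 em; rewrite -mulrnA; apply: (mulrn_modp em).
by rewrite /= {3}Zp_cast // modn_mod.
Qed.

Lemma Zp_eq0_mod m (i : 'Z_m) : (1 < m)%N -> i = 0%N %[mod m] -> i = 0.
Proof.
move=> m_gt1 im; apply: val_inj; rewrite /= -[RHS](mod0n m) -im modn_small //.
by rewrite -[ltnRHS](Zp_cast m_gt1).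
Qed.

Definition from_coord e1 e2 t (x : V) : A := e1 *+ x.1.1 + e2 *+ x.1.2 + t *+ x.2.

Variables (e1 e2 t : A).
Hypotheses (e1p : e1 *+ p = 0) (e2p : e2 *+ p = 0) (t2 : t *+ 2 = 0).

Lemma from_coordD : {morph from_coord e1 e2 t : x y / x + y}.
Proof.
move=> [[x1 x2] x3] [[y1 y2] y3]; rewrite /from_coord /=.
rewrite !mulrn_ZpD ?prime_gt1 //.
by rewrite [in RHS]addrACA; congr (_ + _); rewrite addrACA.
Qed.

Hypotheses (e1_neq0 : e1 != 0) (t_neq0 : t != 0) (e2_free : e2 \notin <[e1]>%g).

Lemma odd_mulrn n : odd n -> t *+ n = t.
Proof.
move=> n_odd; rewrite -(odd_double_half n) n_odd mulrnDr -mul2n mulrnA t2.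
by rewrite mul0rn addr0.
Qed.

Lemma from_coord_inj : injective (from_coord e1 e2 t).
Proof.
suff ker0 x : from_coord e1 e2 t x = 0 -> x = 0.
  move=> x y eqxy; apply: (addIr (- y)); rewrite subrr; apply: ker0.
  apply: (addIr (from_coord e1 e2 t y)).
  by rewrite -from_coordD subrK eqxy add0r.
have p_gt1 := prime_gt1 p_prime; case: x => [[x1 x2] x3] x0.
have x3_0 : x3 = 0.
  (* Multiplication by the odd p kills the [e1] and [e2] terms and fixes [t], which isolates the
     third coordinate. *)
  have := congr1 (fun z => z *+ p) x0; rewrite /from_coord /=.
  rewrite !mulrnDl mul0rn ![_ *+ _ *+ p]mulrnAC e1p e2p !mul0rn !add0r.
  rewrite odd_mulrn // => tx3; apply: (@Zp_eq0_mod 2) => //.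
  apply: (@mulrn_group_mod A 2 isT 1%G t) => //; first exact/set1P/eqP.
  by rewrite tx3 mulr0n subrr group1.
move: x0; rewrite x3_0 /from_coord /= mulr0n addr0 => x0.
have x2_0 : x2 = 0.
  apply: (@Zp_eq0_mod p) => //.
  apply: (mulrn_group_mod p_prime (N := <[e1]>%G) (y := e2)) => //.
  have -> : e2 *+ x2 - e2 *+ 0 = - (e1 *+ x1).
    by rewrite mulr0n subr0 -[RHS]addr0 -x0 addKr.
  by rewrite groupV mem_cycle.
move: x0; rewrite x2_0 mulr0n addr0 => x0; rewrite (_ : x1 = 0) //.
apply: (@Zp_eq0_mod p) => //.
apply: (mulrn_group_mod p_prime (N := 1%G) (y := e1)) => //.
  by apply: contra e1_neq0 => /set1P ->.
by rewrite x0 mulr0n subrr group1.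
Qed.

Lemma from_coord_bij : #|A| = #|{: V}| -> bijective (from_coord e1 e2 t).
Proof.
by move=> oA; apply: inj_card_bij; [exact: from_coord_inj | rewrite oA].
Qed.

End Coordinates.

(** * Normal form of a brace whose kernel has order p *)

Section Uniqueness.
Variables (p : nat) (p_prime : prime p) (p_odd : odd p).
Local Notation V := ('Z_p * 'Z_p * 'Z_2)%type.
Variables (A : finZmodType) (S : left_brace A) (t e0 : A).
Local Notation "a 'o' b" := (circ S a b) (at level 40, left associativity).
Local Notation lam := (lambda S).
Local Notation K := (ker_lambda S).
Hypotheses (oA : #|A| = #|{: V}|) (oK : #|K| = p) (t2 : t *+ 2 = 0).
Hypotheses (t_neq0 : t != 0) (t_uniq : forall x, x *+ 2 = 0 -> x = 0 \/ x = t).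
Hypotheses (expA : forall x : A, x *+ (p * 2) = 0).
Hypotheses (e0p : e0 *+ p = 0) (K'e0 : e0 \notin K).

Let tp : t *+ p = t. Proof. exact: odd_mulrn. Qed.

Lemma lambda_invol a : lam a t = t.
Proof.
have [||//] := @t_uniq (lam a t); first by rewrite -lambdaMn t2 lambdax0.
by rewrite -{1}(lambdax0 S a) => /(can_inj (lambdaK S a))/eqP; rewrite (negPf t_neq0).
Qed.

Lemma ker_torsion k : k \in K -> k *+ p = 0.
Proof. by move=> Kk; rewrite -oK; exact: (@expg_cardG _ (ker_lambda_group S)). Qed.

Lemma lambda_torsion a x : x *+ p = 0 -> lam a x *+ p = 0.
Proof. by move=> xp; rewrite -lambdaMn xp lambdax0. Qed.

Lemma invol_notin_ker : t \notin K.
Proof. by apply: contra t_neq0 => /ker_torsion; rewrite tp => ->. Qed.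

Lemma ker_lambda_cycle k : k \in K -> k != 0 -> K = <[k]>%g.
Proof.
move=> Kk k0; apply: (@nt_gen_prime _ (ker_lambda_group S)); rewrite /= ?oK //.
by rewrite !inE k0; move: Kk; rewrite inE.
Qed.

(** [K] is cyclic of prime order and stable under [lam x], so [k] is an eigenvector; its eigenvalue
    is 1 by unipotence with [N] trivial. *)
Lemma lambda_torsion_ker x k : x *+ p = 0 -> k \in K -> lam x k = k.
Proof.
move=> xp Kk; have [-> | k0] := eqVneq k 0; first exact: lambdax0.
have [m lam_k] : exists m, lam x k = k *+ m.
  by apply/cycleP; rewrite -ker_lambda_cycle ?lambda_ker.
have kp := ker_torsion Kk.
have: lam x k - k \in 1%G.
  apply: (lambda_unipotent p_prime (m := m)) => // [z /set1P->|].
    by rewrite [lam x _]lambdax0 group1.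
  by rewrite lam_k subrr group1.
by move/set1P/subr0_eq.
Qed.

Lemma ker_neq0 : exists2 k, k \in K & k != 0.
Proof.
have: (1 < #|ker_lambda_group S|)%N by rewrite /= oK prime_gt1.
by rewrite cardG_gt1 => /trivgPn.
Qed.

Lemma from_coord_ker_bij k y : k \in K -> k != 0 -> y *+ p = 0 -> y \notin K ->
  bijective (from_coord (p := p) k y t).
Proof.
move=> Kk k0 yp K'y; apply: from_coord_bij => //; first exact: ker_torsion.
by rewrite -ker_lambda_cycle.
Qed.

(** The p-torsion modulo [K] is a line spanned by [y]: in the basis [k], [y], [t] the [t] term of a
    p-torsion element vanishes because p is odd. *)
Lemma torsion_coord y z : y *+ p = 0 -> y \notin K -> z *+ p = 0 ->
  exists n, z - y *+ n \in K.
Proof.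
move=> yp K'y zp; have [k Kk k0] := ker_neq0.
have [g _ gK] := from_coord_ker_bij Kk k0 yp K'y.
have := gK z; case: (g z) => -[x1 x2] x3; rewrite /from_coord /= => def_z.
exists x2; suff -> : z - y *+ x2 = k *+ x1 by rewrite (@groupX _ (ker_lambda_group S)).
suff tx3 : t *+ x3 = 0 by rewrite -def_z tx3 addr0 addrK.
rewrite -tp mulrnAC; have := congr1 (fun u => u *+ p) def_z; rewrite /= zp.
by rewrite !mulrnDl (mulrnAC k) (mulrnAC y) ker_torsion // yp !mul0rn !add0r.
Qed.

Lemma lambda_torsion_mod x y : x *+ p = 0 -> y *+ p = 0 -> lam x y - y \in K.
Proof.
move=> xp yp; have [Ky | K'y] := boolP (y \in K).
  by rewrite lambda_torsion_ker // subrr (group1 (ker_lambda_group S)).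
have [n yn] := torsion_coord yp K'y (lambda_torsion x yp).
apply: (lambda_unipotent p_prime (N := ker_lambda_group S)) yn => //.
by move=> z; apply: lambda_ker.
Qed.

(** The sums x + y and x o y = x + lam x y differ by [lam x y - y], which lies in [K] and is
    invisible to [lambda]. *)
Lemma lambda_torsionD x y z : x *+ p = 0 -> y *+ p = 0 ->
  lam (x + y) z = lam x (lam y z).
Proof.
move=> xp yp; rewrite -lambda_circ circE -[in RHS](subrK y (lam x y)) addrCA.
by rewrite [RHS]lambda_kerD // lambda_torsion_mod.
Qed.

(** The element c = lam y y - y lies in [K] and is fixed by [lam y], so each application of [lam y]
    to [y] adds one more [c]. This is the source of the bilinear term of the formula. *)
Lemma lambda_torsion_iter y m n : y *+ p = 0 ->
  lam (y *+ m) (y *+ n) = y *+ n + (lam y y - y) *+ (m * n).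
Proof.
move=> yp; rewrite lambdaMn mulrnA -mulrnDl; congr (_ *+ _).
have [c def_c] : exists c, lam y y = y + c by exists (lam y y - y); rewrite addrC subrK.
have Kc : c \in K by rewrite -[c](addKr y) -def_c addrC lambda_torsion_mod.
rewrite def_c [_ - y]addrC addKr; elim: m => [|m IHm]; first by rewrite lambda0 addr0.
have ymp : y *+ m *+ p = 0 by rewrite mulrnAC yp mul0rn.
rewrite [y *+ _]mulrS lambda_torsionD // IHm lambdaD lambdaMn.
by rewrite (lambda_torsion_ker yp Kc) def_c mulrS addrA.
Qed.

(** Otherwise [lam y] would fix [K], [y] and [t], which together generate the additive group, and
    [y] would be in the kernel. *)
Lemma lambda_self_neq y : y *+ p = 0 -> y \notin K -> lam y y != y.
Proof.
move=> yp K'y; apply: (contra _ (K'y)) => /eqP fix_y; apply/ker_lambdaP => z.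
have [k Kk k0] := ker_neq0; have [g _ gK] := from_coord_ker_bij Kk k0 yp K'y.
rewrite -(gK z) /from_coord !lambdaD !lambdaMn fix_y lambda_invol.
by rewrite (lambda_torsion_ker yp Kk).
Qed.

(** As [t] is fixed by every [lambda], both t o x and (lam t x) o t equal t + lam t x. *)
Lemma lambda_invol_torsion x y : x *+ p = 0 ->
  lam t (lam x y) = lam (lam t x) (lam t y).
Proof.
move=> xp; rewrite -!lambda_circ; congr (lam _ y).
by rewrite !circE lambda_invol addrC.
Qed.

Lemma lambda_involK : involutive (lam t).
Proof. by move=> y; rewrite -lambda_circ circE lambda_invol -mulr2n t2 lambda0. Qed.

Lemma lambda_invol_ker k : k \in K -> lam t k = k.
Proof.
pose c := lam e0 e0 - e0.
have Kc : c \in K by exact: lambda_torsion_mod.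
have c0 : c != 0 by rewrite subr_eq0 lambda_self_neq.
have [d Kl] := torsion_coord e0p K'e0 (lambda_torsion t e0p).
set l := lam t e0 - e0 *+ d in Kl; have lam_e0 : lam t e0 = l + e0 *+ d by rewrite subrK.
have dd : (d * d)%N = 1%N %[mod p].
  apply: (@mulrn_group_mod A p p_prime (ker_lambda_group S) e0) => //.
  have := lambda_involK e0; rewrite lam_e0 lambdaD lambdaMn lam_e0.
  rewrite mulrnDl addrA -mulrnA => def_e0.
  rewrite mulr1n -{2}def_e0 opprD addrCA subrr addr0 groupV.
  by apply: groupM; [apply: lambda_ker | apply: groupX].
suff tc : lam t c = c.
  by rewrite (ker_lambda_cycle Kc c0) => /cycleP[n ->]; rewrite lambdaMn tc.
(* The left side is lam t c + (l + d e0). On the right the index [l] in [K] drops out, leaving l + d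
   e0 + d^2 c. *)
have := lambda_invol_torsion e0 e0p.
rewrite -{1}[lam e0 e0](subrK e0) -/c lambdaD lam_e0 lambda_kerD // lambdaD.
rewrite lambda_torsion_iter // -/c (mulrn_modp (ker_torsion Kc) dd) mulr1n.
have edp : e0 *+ d *+ p = 0 by rewrite mulrnAC e0p mul0rn.
by rewrite (lambda_torsion_ker edp Kl) addrC [RHS]addrA => /addrI.
Qed.

Lemma lambda_invol_anti : exists e2, [/\ e2 *+ p = 0, e2 \notin K & lam t e2 = - e2].
Proof.
have [y ty] : exists y, lam t y != y.
  apply/existsP; apply: contraR invol_notin_ker; rewrite negb_exists => /forallP all_t.
  by apply/ker_lambdaP => y; apply/eqP; have := all_t y; rewrite negbK.
(* This vector is negated because [lam t] is an involution. It is p-torsion because p y is 0 or [t],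
   both fixed by [lam t]. *)
exists (lam t y - y); have anti : lam t (lam t y - y) = - (lam t y - y).
  by rewrite lambdaB lambda_involK opprB.
have tor : (lam t y - y) *+ p = 0.
  rewrite mulrnBl -lambdaMn; have [] := @t_uniq (y *+ p).
  - by rewrite -mulrnA expA.
  - by move=> ->; rewrite lambdax0 subrr.
  - by move=> ->; rewrite lambda_invol subrr.
(* A vector of [K] is fixed by [lam t]; being negated as well, it is killed by 2 and by the odd
   p. *)
split=> //; apply: contra ty => /lambda_invol_ker; rewrite anti.
move: (lam t y - y) tor (subr_eq0 (lam t y) y) => u up <- uN.
have u2 : u *+ 2 = 0 by rewrite mulr2n -{1}uN addNr.
by rewrite -(odd_mulrn u2 p_odd) up.
Qed.

Lemma left_brace_from_coord : exists2 h : V -> A, bijective h /\ {morph h : x y / x + y}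
  & forall (x1 x2 y1 y2 : 'Z_p) (x3 y3 : 'Z_2),
    h (x1, x2, x3) o h (y1, y2, y3)
    = h (x1 + y1 + (-1) ^+ x3 * x2 * y2, x2 + (-1) ^+ x3 * y2, x3 + y3).
Proof.
have [e2 [e2p K'e2 te2]] := lambda_invol_anti.
pose e1 := lam e2 e2 - e2.
have Ke1 : e1 \in K by exact: lambda_torsion_mod.
have e1p := ker_torsion Ke1.
have p_gt1 := prime_gt1 p_prime.
exists (from_coord e1 e2 t).
  split; last exact: from_coordD.
  by apply: from_coord_ker_bij; rewrite // subr_eq0 lambda_self_neq.
have hE (z1 z2 : 'Z_p) (z3 : 'Z_2) :
  from_coord e1 e2 t (z1, z2, z3) = e1 *+ z1 + e2 *+ z2 + t *+ z3 by [].
move=> x1 x2 y1 y2 x3 y3; rewrite circE !hE.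
set x12 := e1 *+ x1 + e2 *+ x2.
have x12p : x12 *+ p = 0 by rewrite mulrnDl !(mulrnAC _ _ p) e1p e2p !mul0rn addr0.
(* The sum is also the [circ] product of its two terms, since [t] is fixed, and the [e1] part of
   [x12] lies in [K]. *)
have lam_x y : lam (x12 + t *+ x3) y = lam (e2 *+ x2) (lam (t *+ x3) y).
  have -> : x12 + t *+ x3 = x12 o (t *+ x3) by rewrite circE lambdaMn lambda_invol.
  rewrite lambda_circ lambda_kerD //.
  by apply: (@groupX _ (ker_lambda_group S)).
have lam_t3 : lam (t *+ x3) (e1 *+ y1 + e2 *+ y2 + t *+ y3)
    = e1 *+ y1 + e2 *+ ((-1) ^+ x3 * y2 : 'Z_p)%R + t *+ y3.
  have -> : x3 = (odd x3 : nat) :> nat by case: x3 {lam_x} => [[|[|]]].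
  case: (odd x3); rewrite ?mulr0n ?lambda0 ?expr0 ?mul1r //.
  rewrite mulr1n expr1 mulN1r mulrn_ZpN // !lambdaD !lambdaMn.
  by rewrite (lambda_invol_ker Ke1) lambda_invol te2 mulNrn.
set z2 := ((-1) ^+ x3 * y2)%R in lam_t3 *.
have -> : (-1) ^+ x3 * x2 * y2 = x2 * z2 by rewrite mulrAC mulrC.
rewrite lam_x lam_t3 !lambdaD (lambdaMn _ _ t) lambda_invol lambda_torsion_iter // -/e1.
have x2p : e2 *+ x2 *+ p = 0 by rewrite mulrnAC e2p mul0rn.
rewrite (lambdaMn _ _ e1) (lambda_torsion_ker x2p Ke1).
rewrite !mulrn_ZpD // mulrn_ZpM // mulrnA.
rewrite addrACA; congr (_ + _); rewrite /x12 addrACA -[RHS]addrA; congr (_ + _).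
by rewrite addrA addrC.
Qed.

End Uniqueness.

(** * The explicit brace and its kernel *)

Section Model.
Variables (p : nat) (p_prime : prime p) (p_odd : odd p).
Local Notation V := ('Z_p * 'Z_p * 'Z_2)%type.

Lemma coordD (x1 x2 y1 y2 : 'Z_p) (x3 y3 : 'Z_2) :
  (x1, x2, x3) + (y1, y2, y3) = (x1 + y1, x2 + y2, x3 + y3) :> V.
Proof. by []. Qed.

Lemma coordN (x1 x2 : 'Z_p) (x3 : 'Z_2) : - (x1, x2, x3) = (- x1, - x2, - x3) :> V.
Proof. by []. Qed.

Lemma coordMn (x1 x2 : 'Z_p) (x3 : 'Z_2) n :
  (x1, x2, x3) *+ n = (x1 *+ n, x2 *+ n, x3 *+ n) :> V.
Proof. by elim: n => // n IHn; rewrite !mulrS IHn coordD. Qed.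

Lemma mulrn_Zp m (i : 'Z_m) : (1 < m)%N -> i *+ m = 0.
Proof. by move=> m_gt1; rewrite -mulr_natr pchar_Zp // mulr0. Qed.

Definition model_circ (x y : V) : V :=
  (x.1.1 + y.1.1 + (-1) ^+ x.2 * x.1.2 * y.1.2,
   x.1.2 + (-1) ^+ x.2 * y.1.2, x.2 + y.2).

(** Obtained by solving y o x = 0 for y: the second coordinate gives y2, and then the cross term
    (-1)^y3 y2 x2 equals -x2^2. *)
Definition model_inv (x : V) : V :=
  (x.1.2 * x.1.2 - x.1.1, - ((-1) ^+ x.2 * x.1.2), - x.2).

Lemma Z2_case (i : 'Z_2) : i = 0 \/ i = 1.
Proof. by case: i => [[|[|//]]] lt_i; [left | right]; apply: val_inj. Qed.

Lemma signr_Z2D (R : pzRingType) (i j : 'Z_2) :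
  (-1) ^+ (i + j)%R = (-1) ^+ i * (-1) ^+ j :> R.
Proof. by rewrite -exprD -signr_odd -[RHS]signr_odd /= modn2 oddb. Qed.

Lemma signr_sqr (R : pzRingType) n : (-1) ^+ n * (-1) ^+ n = 1 :> R.
Proof. by rewrite -exprD addnn -signr_odd odd_double. Qed.

Lemma model_circA : associative model_circ.
Proof.
move=> [[x1 x2] x3] [[y1 y2] y3] [[z1 z2] z3]; rewrite /model_circ.
cbn [fst snd]; rewrite signr_Z2D.
have := signr_sqr 'Z_p x3; move: ((-1) ^+ x3 : 'Z_p) ((-1) ^+ y3 : 'Z_p) => a b aa.
congr (_, _, _); [|by ring|by ring].
(* The two sides differ only in that one carries a^2 b y2 z2 and the other b y2 z2, where a is a
   sign. *)
by rewrite -[b * y2 * z2]mul1r -aa; ring.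
Qed.

Lemma model_circ1x : left_id 0 model_circ.
Proof.
move=> [[x1 x2] x3]; rewrite /model_circ; cbn [fst snd].
by rewrite expr0 !mul1r !add0r mul0r addr0.
Qed.

Lemma model_circVx : left_inverse 0 model_inv model_circ.
Proof.
move=> [[x1 x2] x3]; rewrite /model_circ /model_inv; cbn [fst snd].
have -> : (-1) ^+ (- x3)%R = (-1) ^+ x3 :> 'Z_p.
  by rewrite -[LHS]signr_odd -[RHS]signr_odd; case: x3 => [[|[|]]].
have := signr_sqr 'Z_p x3; move: ((-1) ^+ x3 : 'Z_p) => a aa.
congr (_, _, _); [|by ring|by ring].
by rewrite mulrN mulrA aa; ring.
Qed.

Lemma model_circD a b c : model_circ a (b + c) = model_circ a b - a + model_circ a c.
Proof.
case: a b c => [[x1 x2] x3] [[y1 y2] y3] [[z1 z2] z3].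
by rewrite coordD /model_circ coordN !coordD; congr (_, _, _); cbn [fst snd]; ring.
Qed.

Definition model := LeftBrace model_circA model_circ1x model_circVx model_circD.

Lemma model_lambda x y : lambda model x y =
  (y.1.1 + (-1) ^+ x.2 * x.1.2 * y.1.2, (-1) ^+ x.2 * y.1.2, y.2).
Proof.
case: x y => [[x1 x2] x3] [[y1 y2] y3].
rewrite /lambda [circ model _ _]/(model_circ _ _) /model_circ coordN coordD.
by congr (_, _, _); cbn [fst snd]; ring.
Qed.

Lemma signr_eq1 (i : 'Z_2) : (-1) ^+ i = 1 :> 'Z_p -> i = 0.
Proof.
rewrite -signr_odd; case: i => [[|[|]]] //= ?; first by move=> _; apply: val_inj.
have p_gt1 := prime_gt1 p_prime.
rewrite expr1 => /(congr1 (+%R 1)); rewrite subrr -mulr2n => /esym /(congr1 val) /=.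
by rewrite !Zp_cast // modnDm modn_small // odd_prime_gt2.
Qed.

Lemma card_ker_model : #|ker_lambda model| = p.
Proof.
have p_gt1 := prime_gt1 p_prime.
have -> : ker_lambda model = [set ((x, 0, 0) : V) | x in 'Z_p].
  apply/setP => -[[x1 x2] x3]; apply/ker_lambdaP/imsetP => [Kx | [i _ [-> -> ->]] y].
    (* One test vector suffices: its image is ((-1)^x3 x2, (-1)^x3, 0), which forces x3 = 0 since -1
       differs from 1 modulo p, and then x2 = 0. *)
    have := Kx (0, 1, 0); rewrite model_lambda; cbn [fst snd] => K01.
    have /signr_eq1 x3_0 : (-1) ^+ x3 = 1 :> 'Z_p.
      by have := congr1 (fun v : V => v.1.2) K01; cbn [fst snd]; rewrite mulr1.
    have := congr1 (fun v : V => v.1.1) K01; cbn [fst snd].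
    by rewrite x3_0 expr0 mul1r add0r mulr1 => ->; exists x1.
  case: y => [[y1 y2] y3]; rewrite model_lambda; cbn [fst snd].
  by rewrite expr0 mulr0 mul0r addr0 mul1r.
rewrite card_imset => [|x y /(congr1 (fun v : V => v.1.1)) //].
by rewrite card_ord Zp_cast.
Qed.

End Model.

Lemma brace_isomorphic_sym (A A' : finZmodType) (S : left_brace A)
    (S' : left_brace A') : brace_isomorphic S S' -> brace_isomorphic S' S.
Proof.
move=> [f [[g fK gK] fD fo]]; exists g; split; first by exists f.
  by move=> x y; apply: (can_inj fK); rewrite fD !gK.
by move=> x y; apply: (can_inj fK); rewrite fo !gK.
Qed.

(** * Every brace of the given type is isomorphic to the model *)

Section ModelUnique.
Variables (p : nat) (p_prime : prime p) (p_odd : odd p).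
Local Notation V := ('Z_p * 'Z_p * 'Z_2)%type.

Lemma model_unique (A : finZmodType) (S : left_brace A) :
  ([set: A] \isog [set: V])%g -> #|ker_lambda S| = p ->
  brace_isomorphic S (model p).
Proof.
move=> isoAV oK; have p_gt1 := prime_gt1 p_prime.
have oA : #|A| = #|{: V}| by rewrite -!cardsT (card_isog isoAV).
have [f f_inj fD] : exists2 f : V -> A, injective f & {morph f : x y / x + y}.
  have [f /injmP injf _] := isogP (isog_symr isoAV); exists f.
    by move=> x y /injf; apply; rewrite inE.
  by move=> x y; apply: (morphM f); rewrite inE.
have [g fK gK] : bijective f by apply: inj_card_bij; rewrite ?oA.
have f0 : f 0 = 0 by apply: (addIr (f 0)); rewrite -fD !add0r.
have fMn x n : f (x *+ n) = f x *+ n.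
  by elim: n => [|n IHn]; rewrite ?mulr0n ?f0 // !mulrS fD IHn.
pose t := f (0, 0, 1).
(* By counting: the image of the first two coordinates has p^2 elements, the kernel only p. *)
have [e0 e0p K'e0] : exists2 e0 : A, e0 *+ p = 0 & e0 \notin ker_lambda S.
  have [z K'z | allK] := pickP (fun z : 'Z_p * 'Z_p => f (z, 0) \notin ker_lambda S).
    exists (f (z, 0)) => //; rewrite -fMn; case: z {K'z} => z1 z2.
    by rewrite coordMn mul0rn !mulrn_Zp.
  have: (#|[set f (z, 0)%R | z : 'Z_p * 'Z_p]| <= #|ker_lambda S|)%N.
    by apply/subset_leq_card/subsetP => _ /imsetP[z _ ->]; apply/negPn/negbT/allK.
  rewrite card_imset => [|z z' /f_inj[] //].
  rewrite card_prod card_ord Zp_cast // oK leqNgt -[ltnLHS]muln1.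
  by rewrite ltn_pmul2l ?p_gt1 // ltnW.
have t2 : t *+ 2 = 0 by rewrite -fMn coordMn !mul0rn mulrn_Zp.
have t_neq0 : t != 0 by rewrite -f0 (inj_eq f_inj).
have Zp2_eq0 (i : 'Z_p) : i *+ 2 = 0 -> i = 0.
  by move=> i2; rewrite -(odd_mulrn i2 p_odd) mulrn_Zp.
have t_uniq x : x *+ 2 = 0 -> x = 0 \/ x = t.
  rewrite -(gK x) -fMn -{1}f0; case: (g x) => -[x1 x2] x3 /f_inj; rewrite coordMn => x2_0.
  have -> : x1 = 0 by exact: Zp2_eq0 (congr1 (fun v : V => v.1.1) x2_0).
  have -> : x2 = 0 by exact: Zp2_eq0 (congr1 (fun v : V => v.1.2) x2_0).
  by have [-> | ->] := Z2_case x3; [left | right].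
have expA x : x *+ (p * 2) = 0 :> A.
  rewrite -(gK x) -fMn; case: (g x) => -[x1 x2] x3; rewrite coordMn.
  by rewrite ![_ *+ (p * 2)]mulrnA !(mulrn_Zp _ p_gt1) mulrnAC mulrn_Zp // !mul0rn.
have [h [h_bij hD] hM] :=
  left_brace_from_coord p_prime p_odd oA oK t2 t_neq0 t_uniq expA e0p K'e0.
apply: brace_isomorphic_sym; exists h; split=> //.
by move=> [[x1 x2] x3] [[y1 y2] y3]; rewrite hM.
Qed.

End ModelUnique.

(** * The presentation of the multiplicative group *)

Lemma mem_join3_cycle (gT : finGroupType) (x y z : gT) i j k :
  (x ^+ i * y ^+ j * z ^+ k \in <[x]> <*> <[y]> <*> <[z]>)%g.
Proof.
apply: groupM; [apply: groupM|]; apply: groupX.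
- by rewrite !mem_gen // inE mem_gen // inE cycle_id.
- by rewrite !mem_gen // inE mem_gen // inE cycle_id orbT.
- by rewrite mem_gen // inE cycle_id orbT.
Qed.

Lemma homGrpP (p : nat) (rT : finGroupType) (H : {set rT}) :
  reflect (exists x y z : rT, [/\ <[x]> <*> <[y]> <*> <[z]> = H,
      [/\ x ^+ p = 1, y ^+ p = 1 & z ^+ 2 = 1], commute x y,
      z * x * z^-1 = x^-1 & z * y * z^-1 = y])%g
    (H \homg Grp (s : t : e :
       (s ^+ p, t ^+ p, e ^+ 2, [~ s, t], e * s * e^-1 = s^-1, e * t * e^-1 = t)))%g.
Proof.
apply: (iffP existsP) => [[[[x y] z] /= /eqP[defH xp yp z2 xy zx zy]] | ].
  by exists x, y, z; split=> //; apply/commgP/eqP.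
case=> x [y [z [defH [xp yp z2] /commgP/eqP xy zx zy]]].
by exists (x, y, z); rewrite /= defH xp yp z2 xy zx zy.
Qed.

Section Presentation.
Variables (p : nat) (p_prime : prime p) (p_odd : odd p).
Local Notation V := ('Z_p * 'Z_p * 'Z_2)%type.
Local Notation gT := (circ_group (model p)).

Let p_gt1 : (1 < p)%N := prime_gt1 p_prime.

(** The inverse of 2, as p is odd. Conjugating (h, 1, 0) by [e] gives (h, -1, 0), whereas its
    inverse is (1 - h, -1, 0); the relation between [e] and [s] therefore forces h = 1/2. *)
Let half : 'Z_p := (p./2.+1)%:R.

Lemma half_double : half + half = 1.
Proof.
have def_p : (p./2.+1 + p./2.+1 = p.+1)%N.
  by rewrite -[in RHS](odd_double_half p) p_odd -addnn addSn addnS.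
by rewrite /half -natrD def_p mulrSr pchar_Zp // add0r.
Qed.

Lemma modelM (x y : gT) : (x * y)%g = model_circ x y.
Proof. by []. Qed.

Let s : gT := (half, 1, 0).
Let t : gT := (1, 0, 0).
Let e : gT := (0, 0, 1).

Lemma model_expg_s n : (s ^+ n)%g = (half * n%:R ^+ 2, n%:R, 0) :> V.
Proof.
elim: n => [|n IHn]; first by rewrite expr0n mulr0.
rewrite expgSr modelM IHn /model_circ; cbn [fst snd]; rewrite expr0 !mul1r mulr1 addr0.
rewrite -[n.+1]addn1 natrD; congr (_, _, _).
transitivity (half * n%:R ^+ 2 + half + (half + half) * n%:R); last by ring.
by rewrite half_double mul1r.
Qed.

Lemma model_expg_t n : (t ^+ n)%g = (n%:R, 0, 0) :> V.
Proof.
elim: n => [|n IHn] //.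
rewrite expgSr modelM IHn /model_circ; cbn [fst snd].
by rewrite -[n.+1]addn1 natrD !mulr0 !addr0.
Qed.

Lemma model_expg_e (i : 'Z_2) : (e ^+ i)%g = (0, 0, i) :> V.
Proof.
case: i => [[|[|//]]] lt_i; rewrite /= ?expg1; congr (_, _, _); exact: val_inj.
Qed.

(** The power of [s] already contributes x2^2/2 to the first coordinate, and the exponent of [t]
    compensates for it. *)
Lemma model_decomp (v : V) :
  (s ^+ v.1.2 * t ^+ (v.1.1 - half * v.1.2 ^+ 2)%R * e ^+ v.2)%g = v.
Proof.
case: v => [[x1 x2] x3]; cbn [fst snd].
rewrite !modelM model_expg_s model_expg_t model_expg_e !natr_Zp /model_circ.
cbn [fst snd]; rewrite !mulr0 ?addr0 ?add0r ?expr0.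
by congr (_, _, _); ring.
Qed.

Lemma model_homGrp : ([set: gT] \homg Grp (s : t : e :
   (s ^+ p, t ^+ p, e ^+ 2, [~ s, t], e * s * e^-1 = s^-1, e * t * e^-1 = t)))%g.
Proof.
have sp : (s ^+ p = 1)%g.
  by rewrite model_expg_s pchar_Zp // expr0n mulr0.
have tp : (t ^+ p = 1)%g by rewrite model_expg_t pchar_Zp.
have e2 : (e ^+ 2 = 1)%g.
  rewrite expgS expg1 modelM /model_circ /e; cbn [fst snd].
  by rewrite !mulr0 !addr0; congr (_, _, _); apply: val_inj.
have st : commute s t.
  rewrite /commute !modelM /model_circ /s /t /e; cbn [fst snd].
  by congr (_, _, _); ring.
have es : (e * s * e^-1 = s^-1)%g.
  apply: (mulIg e); rewrite mulgKV; apply: (mulgI s); rewrite mulKVg.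
  rewrite !modelM /model_circ /s /t /e; cbn [fst snd]; rewrite expr0 expr1 mulr0 mul0r.
  congr (_, _, _); [|by ring|by ring].
  by transitivity (half + half - 1); [ring | rewrite half_double subrr].
have et : (e * t * e^-1 = t)%g.
  apply: (mulIg e); rewrite mulgKV !modelM /model_circ /s /t /e; cbn [fst snd].
  by congr (_, _, _); ring.
have gen : (<[s]> <*> <[t]> <*> <[e]>)%g = [set: gT].
  apply/eqP; rewrite eqEsubset subsetT; apply/subsetP => v _.
  by rewrite -(model_decomp v) mem_join3_cycle.
by apply/homGrpP; exists s, t, e.
Qed.

(** The words of [model_decomp], evaluated at generators of [H] that satisfy the relations, define a
    morphism from the model onto [H]. *)
Lemma homGrp_model (rT : finGroupType) (H : {group rT}) :
  (H \homg Grp (s : t : e :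
     (s ^+ p, t ^+ p, e ^+ 2, [~ s, t], e * s * e^-1 = s^-1, e * t * e^-1 = t)))%g ->
  (H \homg [set: gT])%g.
Proof.
case/homGrpP=> x [y [z [defH [xp yp z2] cxy zx zy]]].
pose phi (v : gT) := (x ^+ v.1.2 * y ^+ (v.1.1 - half * v.1.2 ^+ 2)%R * z ^+ v.2)%g.
have czy : commute z y by apply: (mulIg z^-1)%g; rewrite zy mulgK.
have zxn n : (z * x ^+ n = x ^- n * z)%g.
  have xJ : (x ^ z^-1 = x^-1)%g by rewrite conjgE invgK -zx mulgA.
  by rewrite -expgVn -xJ -conjXg conjgE invgK -!mulgA mulVg mulg1.
have phiM : {in [set: gT] &, {morph phi : v w / (v * w)%g}}.
  move=> [[v1 v2] v3] [[w1 w2] w3] _ _; rewrite modelM /phi /model_circ.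
  cbn [fst snd]; set b := (v1 - _)%R; set b' := (w1 - _)%R.
  (* The cross term of the square, halved, cancels the bilinear term of [model_circ], so the
     exponents of [y] simply add. *)
  have -> : v1 + w1 + (-1) ^+ v3 * v2 * w2 - half * (v2 + (-1) ^+ v3 * w2) ^+ 2 = b + b'.
    have := signr_sqr 'Z_p v3; move: ((-1) ^+ v3 : 'Z_p) => a aa.
    rewrite /b /b'.
    transitivity (v1 + w1 + a * v2 * w2 - half * v2 ^+ 2
       - (half + half) * (a * v2 * w2) - half * (a * a) * w2 ^+ 2); first by ring.
    by rewrite half_double aa; ring.
  move: b b' => b b'; rewrite !expg_ZpD //.
  have zy_comm : commute (z ^+ v3)%g (y ^+ b')%g by apply: commuteX2.
  (* Moving the power of [z] past that of [x] produces exactly the sign in the second coordinate of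
     [model_circ]. *)
  have zxv : (z ^+ v3 * x ^+ w2 = x ^+ ((-1) ^+ v3 * w2)%R * z ^+ v3)%g.
    have [-> | ->] := Z2_case v3; first by rewrite expr0 mul1r expg0 mul1g mulg1.
    by rewrite expr1 mulN1r expg1 zxn expg_ZpN.
  rewrite -!mulgA; congr (_ * _)%g.
  rewrite [in RHS](mulgA (z ^+ v3)%g) zxv -mulgA (mulgA (z ^+ v3)%g) zy_comm -mulgA.
  by rewrite !mulgA (commuteX2 _ _ cxy).
have phiE (v : V) : phi v = Morphism phiM v by [].
apply/homgP; exists (Morphism phiM); apply/eqP; rewrite eqEsubset; apply/andP; split.
  apply/subsetP => _ /morphimP[v _ _ ->]; rewrite -phiE /phi -defH.
  exact: mem_join3_cycle.
have im_phi v : phi v \in (Morphism phiM @* [set: gT])%g.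
  by rewrite phiE mem_morphim ?inE.
have phi_s : phi s = x.
  rewrite /phi /s; cbn [fst snd]; rewrite expr1n mulr1 subrr !expg0 !mulg1.
  exact: expg1.
have phi_t : phi t = y.
  rewrite /phi /t; cbn [fst snd]; rewrite expr0n mulr0 subr0 !expg0 mulg1 mul1g.
  exact: expg1.
have phi_e : phi e = z.
  rewrite /phi /e; cbn [fst snd]; rewrite expr0n mulr0 subr0 !expg0 !mul1g.
  exact: expg1.
by rewrite -defH !join_subG !cycle_subG -{1}phi_s -{1}phi_t -{1}phi_e !im_phi.
Qed.

Lemma model_isoGrp : ([set: gT] \isog Grp (s : t : e :
   (s ^+ p, t ^+ p, e ^+ 2, [~ s, t], e * s * e^-1 = s^-1, e * t * e^-1 = t)))%g.
Proof. exact: intro_isoGrp model_homGrp homGrp_model. Qed.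

End Presentation.

Theorem proposition3p9 (p : nat) (p_prime : prime p) (p_odd : odd p) :
  exists B : left_brace ('Z_p * 'Z_p * 'Z_2)%type,
    [/\ (forall (x1 x2 y1 y2 : 'Z_p) (x3 y3 : 'Z_2),
          (x1, x2, x3) + (y1, y2, y3) = (x1 + y1, x2 + y2, x3 + y3)
          /\ circ B (x1, x2, x3) (y1, y2, y3)
             = (x1 + y1 + (-1) ^+ x3 * x2 * y2, x2 + (-1) ^+ x3 * y2, x3 + y3)),
        #|ker_lambda B| = p,
        (forall (A : finZmodType) (S : left_brace A),
          ([set: A] \isog [set: ('Z_p * 'Z_p * 'Z_2)%type])%g ->
          #|ker_lambda S| = p ->
          brace_isomorphic S B)
      & ([set: circ_group B] \isog Grp (s : t : e :
          (s ^+ p, t ^+ p, e ^+ 2, [~ s, t],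
           e * s * e^-1 = s^-1, e * t * e^-1 = t)))%g].
Proof.
exists (model p); split.
- by [].
- exact: card_ker_model.
- exact: model_unique.
- exact: model_isoGrp.
Qed.
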